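(* Let $T$ be a tree of order $n\geq 2$ and let $w$ be a normalised weight function on $E(T)$. Then $$\mathrm{avec}(T,w)\leq n-1.$$ Equality holds if and only if there exists an edge $e$ of $T$ with $w(e)=n-1$.
   Context: Graphs are finite and simple; the order is the number of vertices. For a connected graph $G$ with $n$ vertices and $m$ edges, a weight function is a map $w:E(G)\to\mathbb{R}^{\geq 0}$; it is called normalised if $\sum_{e\in E(G)}w(e)=m$ (so for a tree on $n$ vertices the total weight is $n-1$). The weighted distance $d_w(u,v)$ is the minimum, over all paths between $u$ and $v$ in $G$, of the sum of the weights of the edges of the path. The weighted eccentricity of a vertex $v$ is $e_w(v)=\max_{u\in V(G)}d_w(u,v)$, and the average eccentricity is $\mathrm{avec}(G,w)=\frac1n\sum_{v\in V(G)}e_w(v)$. *)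

(* Defs.v *)
From HB Require Import structures.
From mathcomp Require Import all_boot all_order all_algebra.
Set Implicit Arguments.
Unset Strict Implicit.
Unset Printing Implicit Defensive.
Import Order.TTheory GRing.Theory Num.Theory.
Local Open Scope ring_scope.

Record sgraph := SGraph {
  vertex :> finType;
  adj : rel vertex;
  adj_sym : symmetric adj;
  adj_irrefl : irreflexive adj }.

Definition edges (G : sgraph) : {set {set G}} :=
  [set e | [exists x, exists y, adj x y && (e == [set x; y])]].

Definition connected_graph (G : sgraph) : Prop :=
  forall x y : G, connect (@adj G) x y.

(* [ucycle] also accepts [:: x; y] with x, y adjacent, hence the size bound. *)
Definition acyclic_graph (G : sgraph) : Prop :=
  forall c : seq G, (2 < size c)%N -> ~ ucycle (@adj G) c.

Definition is_tree (G : sgraph) : Prop := connected_graph G /\ acyclic_graph G.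

Section Weights.
Variables (R : realFieldType) (G : sgraph).

(* Only the values of w on [edges G] are ever used. *)
Variable w : {set G} -> R.

Definition weight_function : Prop := forall e, e \in edges G -> 0 <= w e.

Definition normalised : Prop := \sum_(e in edges G) w e = #|edges G|%:R.

(* A path is represented by its first vertex u and the sequence p of the
   vertices that follow it, as in [path]; simplicity bounds the size of p. *)
Definition paths (u v : G) : {set #|G|.-bseq G} :=
  [set p : #|G|.-bseq G |
    [&& path (@adj G) u p, last u p == v & uniq (u :: p)]].

Definition path_weight (u : G) (p : seq G) : R :=
  \sum_(xy <- zip (u :: p) p) w [set xy.1; xy.2].

(* The head of the list is only the starting value of the iterated minimum;
   the list is nonempty as soon as G is connected. *)
Definition wdist (u v : G) : R :=
  let s := [seq path_weight u p | p : #|G|.-bseq G in paths u v] in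
  \big[Num.min/head 0 s]_(x <- s) x.

Definition wecc (v : G) : R := \big[Num.max/wdist v v]_(u : G) wdist u v.

Definition avec : R := (\sum_(v : G) wecc v) / #|G|%:R.

End Weights.

(* Main.v *)
Require Import Defs.
From mathcomp Require Import all_boot all_order all_algebra.
Import Order.TTheory GRing.Theory Num.Theory.
Local Open Scope ring_scope.

Set Implicit Arguments.
Unset Strict Implicit.

(** The upper bound holds because a simple path uses each edge at most once,
    so its weight is at most the total weight [m], and a tree with [n] vertices
    has [m = n - 1] edges.  Everything else rests on one fact: every edge [e]
    of an acyclic graph is a bridge ([edge_is_bridge]), whereas in a connected
    graph every vertex can still be joined, after the deletion of [e = {x, y}],
    to [x] or to [y] ([connect_end]).

    Counting edges ([card_edges_tree]): fix a root [r] and map each vertex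
    [y != r] to the first edge of some simple path from [y] to [r].  This map is
    a bijection onto the edges, the inverse sending an edge to the end of it
    that the bridge separates from [r].

    If some edge [e = {x, y}] carries the whole weight, then each vertex [v] is
    separated from [x] or from [y] by the bridge [e], hence is at distance at
    least [n - 1] from that end ([separated_wdist]), and all eccentricities
    equal [n - 1].

    Conversely, suppose that all eccentricities equal [n - 1] but that two edges
    [e = {a, b}] and [f] have positive weight.  Up to exchanging [a] and [b],
    the edge [f] lies on the side of [a] when [e] is deleted.  Some simple path
    with endpoint [a] has the full weight [n - 1], so it contains both [e] and
    [f].  But a simple path that ends at [a] and contains [e] ends with the step
    from [b] to [a], so all of its other vertices lie on the side of [b]
    ([path_to_end]), which contradicts the position of [f]. *)

(** * Edges and deletion of an edge *)

(** Adjacency in the graph obtained from [G] by deleting the edge [e]. *)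
Definition del (G : sgraph) (e : {set G}) : rel G :=
  [rel x y | adj x y && ([set x; y] != e)].

(** The edges traversed, in order, by the walk [u :: p]. *)
Definition edge_seq (G : sgraph) (u : G) (p : seq G) : seq {set G} :=
  [seq [set xy.1; xy.2] | xy <- zip (u :: p) p].

Lemma edgesP (G : sgraph) (e : {set G}) :
  reflect (exists x y, adj x y /\ e = [set x; y]) (e \in edges G).
Proof.
rewrite inE; apply: (iffP existsP) => [[x /existsP[y /andP[xy /eqP->]]]|].
  by exists x, y.
by case=> x [y [xy ->]]; exists x; apply/existsP; exists y; rewrite xy eqxx.
Qed.

Lemma adj_neq (G : sgraph) (x y : G) : adj x y -> x != y.
Proof. by apply: contraTneq => ->; rewrite adj_irrefl. Qed.

Lemma connect_del_sym (G : sgraph) (e : {set G}) : connect_sym (del e).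
Proof. by apply: sym_connect_sym => x y; rewrite /del /= adj_sym setUC. Qed.

Lemma set2_eq2l (T : finType) (x y z : T) :
  x != y -> [set x; y] = [set x; z] -> y = z.
Proof.
by move=> xy /setP/(_ y); rewrite !inE eqxx orbT eq_sym (negPf xy) => /esym/eqP.
Qed.

Lemma edge_seq_edges (G : sgraph) (u : G) (p : seq G) :
  path (@adj G) u p -> {subset edge_seq u p <= edges G}.
Proof.
elim: p u => [|v p IHp] u //= /andP[uv pth] e; rewrite inE => /predU1P[->|].
  by apply/edgesP; exists u, v.
exact: IHp.
Qed.

Lemma edge_seq_mem (G : sgraph) (u x : G) (p : seq G) (e : {set G}) :
  e \in edge_seq u p -> x \in e -> x \in u :: p.
Proof.
elim: p u => [|v p IHp] u //=; rewrite inE => /predU1P[->|ep xe].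
  by rewrite !inE => /orP[] ->; rewrite ?orbT.
by rewrite in_cons (IHp v) ?orbT.
Qed.

Lemma edge_seq_uniq (G : sgraph) (u : G) (p : seq G) :
  uniq (u :: p) -> uniq (edge_seq u p).
Proof.
elim: p u => [|v p IHp] u //= /andP[up Up]; rewrite (IHp v) // andbT.
by apply: contra up => /edge_seq_mem; apply; rewrite !inE eqxx.
Qed.

Lemma path_del (G : sgraph) (e : {set G}) (u : G) (p : seq G) :
  path (@adj G) u p -> e \notin edge_seq u p -> path (del e) u p.
Proof.
elim: p u => [|v p IHp] u //= /andP[uv pth]; rewrite inE negb_or eq_sym.
by case/andP=> uve ep; rewrite {1}/del /= uv uve IHp.
Qed.

Lemma connect_del (G : sgraph) (e : {set G}) (u v : G) (p : seq G) :
  path (@adj G) u p -> last u p = v -> e \notin edge_seq u p ->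
  connect (del e) u v.
Proof. by move=> pth <- ep; apply/connectP; exists p; rewrite ?path_del. Qed.

Lemma simple_path (G : sgraph) (u v : G) : connected_graph G ->
  exists p, [/\ path (@adj G) u p, last u p = v & uniq (u :: p)].
Proof.
by move=> /(_ u v)/connectP[p pth ->]; case/shortenP: pth => q; exists q.
Qed.

(** * Bridges *)

Lemma edge_is_bridge (G : sgraph) (x y : G) :
  acyclic_graph G -> adj x y -> ~ connect (del [set x; y]) x y.
Proof.
move=> acG xy /connectP[p pth ly]; case/shortenP: pth ly => q pth Uq _ ly.
have adjq : path (@adj G) x q by apply: sub_path pth => a b /andP[].
have szq : (2 < size (x :: q))%N.
  case: q pth ly {Uq adjq} => [_ /= yx|z [/andP[/andP[_]] + _ /= yz|]] //.
    by rewrite yx adj_irrefl in xy.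
  by rewrite yz eqxx.
apply: (acG (x :: q) szq); apply/andP; split=> //=.
by rewrite rcons_path adjq -ly adj_sym.
Qed.

Lemma connect_end (G : sgraph) (x y v : G) : connected_graph G ->
  connect (del [set x; y]) v x \/ connect (del [set x; y]) v y.
Proof.
move=> cG; have [p [pth + _]] := simple_path v x cG.
elim: p v pth => [|z p IHp] v /=; first by move=> _ ->; left.
case/andP=> vz /IHp{}IHp /IHp.
have [vzxy _|ne] := eqVneq [set v; z] [set x; y].
  have : v \in [set x; y] by rewrite -vzxy !inE eqxx.
  by rewrite !inE => /orP[/eqP->|/eqP->]; [left|right].
have dvz : connect (del [set x; y]) v z by apply: connect1; rewrite /del /= vz.
by case=> [|]; [left|right]; apply: connect_trans dvz _.
Qed.

(** An edge incident with the starting vertex of a simple path can only be its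
    first edge. *)
Lemma edge_seq_head (G : sgraph) (y z : G) (p : seq G) (e : {set G}) :
  uniq (y :: z :: p) -> e \in edge_seq y (z :: p) -> y \in e ->
  e = [set y; z].
Proof.
move=> /andP[yp _]; rewrite inE => /predU1P[->//|ep ye].
by rewrite (edge_seq_mem ep ye) in yp.
Qed.

Lemma path_to_end (G : sgraph) (a b u c : G) (p : seq G) :
  path (@adj G) u p -> last u p = a -> uniq (u :: p) ->
  [set a; b] \in edge_seq u p -> c \in u :: p -> c != a ->
  connect (del [set a; b]) c b.
Proof.
elim: p u c => [|v p IHp] u c //= /andP[uv pth] la /andP[up Up].
have av : a \in v :: p by rewrite -la mem_last.
have ua : a != u by apply: contraTneq av => ->.
rewrite inE => /predU1P[ab|ep].
  have {}av : a = v.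
    have : a \in [set u; v] by rewrite -ab !inE eqxx.
    by rewrite !inE (negPf ua) /= => /eqP.
  (* the first edge already reaches [a], so the path stops there *)
  case: p pth la up Up av {IHp} => [|z p] /= pth la up Up av; last first.
    by case/andP: Up; rewrite -av -la mem_last.
  move: ab; rewrite av setUC => /esym.
  rewrite setUC [RHS]setUC -av => /(@set2_eq2l _ _ _ _ ua) <-.
  by rewrite !inE => /orP[/eqP->|/eqP->]; rewrite ?eqxx.
have IHv := IHp v _ pth la Up ep.
rewrite inE => /predU1P[->{c} _|cp]; last exact: IHv.
have va : v != a.
  apply: contraTneq ep => va; case: p pth la up Up {IHp av IHv} => [|z p] //.
  by move=> _ /= la _ /andP[]; rewrite va -la mem_last.
apply: connect_trans (IHv v _ va); last by rewrite inE eqxx.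
apply: connect1; rewrite /del /= uv; apply/eqP => /setP/(_ a).
by rewrite !inE (negPf ua) eq_sym (negPf va) eqxx.
Qed.

(** * The number of edges of a tree *)

Lemma card_edges_tree (G : sgraph) (r : G) :
  is_tree G -> #|edges G| = #|G|.-1.
Proof.
case=> cG acG.
(* [h y] is the vertex following [y] on some simple path from [y] to [r] *)
have /fin_all_exists[h hP] : forall y : G, exists z, y != r -> exists p,
    [/\ path (@adj G) y (z :: p), last z p = r & uniq (y :: z :: p)].
  move=> y; have [[|z p] [pth lr Up]] := simple_path y r cG.
    by exists y; rewrite -lr eqxx.
  by exists z => _; exists p.
pose g y := [set y; h y].
have conn_h y : y != r -> connect (del (g y)) (h y) r.
  move=> yr; have [p [/= /andP[_ pth] lr /andP[yp _]]] := hP y yr.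
  apply: (connect_del pth lr); apply: contra yp => /edge_seq_mem; apply.
  by rewrite !inE eqxx.
have adj_h y : y != r -> adj y (h y).
  by case/hP=> p [/= /andP[]].
have g_inj : {in [set~ r] &, injective g}.
  move=> y y'; rewrite !inE => yr y'r gE; apply/eqP/negP => /negP ne.
  have y'E : y' = h y.
    have : y' \in g y by rewrite gE !inE eqxx.
    by rewrite !inE eq_sym (negPf ne) /= => /eqP.
  have yE : y = h y'.
    have : y \in g y' by rewrite -gE !inE eqxx.
    by rewrite !inE (negPf ne) /= => /eqP.
  apply: (edge_is_bridge acG (adj_h y yr)); rewrite connect_del_sym.
  apply: connect_trans (conn_h y yr) _; rewrite connect_del_sym gE.
  by rewrite [X in connect _ X]yE conn_h.
suff -> : edges G = g @: [set~ r] by rewrite card_in_imset // cardsC1.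
apply/setP => e; apply/idP/imsetP => [/edgesP[a [b [ab eE]]]|].
  have [y ye yr] : exists2 y, y \in e & ~ connect (del e) y r.
    have [ar|] := boolP (connect (del e) a r); last first.
      by move/negP; exists a => //; rewrite eE !inE eqxx.
    exists b => [|br]; first by rewrite eE !inE eqxx orbT.
    apply: (edge_is_bridge acG ab); rewrite -eE.
    by apply: connect_trans ar _; rewrite connect_del_sym.
  have y_r : y != r by apply/eqP => yE; apply: yr; rewrite yE connect0.
  exists y; first by rewrite !inE.
  have [p [pth lr Up]] := hP y y_r.
  apply: (edge_seq_head Up) => //; apply/negPn/negP => ep.
  exact: yr (connect_del pth lr ep).
case=> y; rewrite !inE => yr ->; apply/existsP; exists y; apply/existsP.
by exists (h y); rewrite adj_h // eqxx.
Qed.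

(** * Path weights and distances *)

Lemma path_weightE (R : realFieldType) (G : sgraph) (w : {set G} -> R)
    (u : G) (p : seq G) :
  path_weight w u p = \sum_(e <- edge_seq u p) w e.
Proof. by rewrite /path_weight /edge_seq big_map. Qed.

Lemma path_weight_split (R : realFieldType) (G : sgraph) (w : {set G} -> R)
    (u : G) (p : seq G) :
  path (@adj G) u p -> uniq (u :: p) ->
  \sum_(e in edges G) w e =
  path_weight w u p + \sum_(e in edges G | e \notin edge_seq u p) w e.
Proof.
move=> pth Up; rewrite (bigID (mem (edge_seq u p))) /=; congr (_ + _).
rewrite path_weightE big_uniq ?edge_seq_uniq //=; apply: eq_bigl => e.
by rewrite andb_idl //; apply: edge_seq_edges.
Qed.

Lemma path_weight_le (R : realFieldType) (G : sgraph) (w : {set G} -> R)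
    (u : G) (p : seq G) :
  weight_function w -> path (@adj G) u p -> uniq (u :: p) ->
  path_weight w u p <= \sum_(e in edges G) w e.
Proof.
move=> w0 pth Up; rewrite (path_weight_split w pth Up) lerDl.
by apply: sumr_ge0 => e /andP[/w0].
Qed.

Lemma full_path_edge (R : realFieldType) (G : sgraph) (w : {set G} -> R)
    (u : G) (p : seq G) (f : {set G}) :
  weight_function w -> path (@adj G) u p -> uniq (u :: p) ->
  \sum_(e in edges G) w e <= path_weight w u p ->
  f \in edges G -> 0 < w f -> f \in edge_seq u p.
Proof.
move=> w0 pth Up; rewrite (path_weight_split w pth Up) gerDl => le0 fG wf.
apply/negPn/negP => fp; move: le0; rewrite (bigD1 f) ?fG //= leNgt => /negP[].
by apply: ltr_wpDr => //; apply: sumr_ge0 => e /andP[/andP[/w0]].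
Qed.

Lemma path_weight_ge_edge (R : realFieldType) (G : sgraph) (w : {set G} -> R)
    (u : G) (p : seq G) (e : {set G}) :
  weight_function w -> path (@adj G) u p -> e \in edge_seq u p ->
  w e <= path_weight w u p.
Proof.
move=> w0 pth ep; rewrite path_weightE (big_rem e) //= lerDl big_seq.
by apply: sumr_ge0 => f /mem_rem/(edge_seq_edges pth)/w0.
Qed.

Lemma wdist_le (R : realFieldType) (G : sgraph) (w : {set G} -> R)
    (u v : G) (p : seq G) :
  path (@adj G) u p -> last u p = v -> uniq (u :: p) ->
  wdist w u v <= path_weight w u p.
Proof.
move=> pth lv Up.
have szp : (size p <= #|G|)%N.
  by apply/ltnW; rewrite (leq_trans _ (max_card (mem (u :: p)))) ?(card_uniqP Up).
rewrite /wdist /=; apply: (@ge_bigmin_seq _ _ _ _ _ _ xpredT id) => //.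
apply/imageP; exists (Bseq szp) => //.
by rewrite inE /= pth lv eqxx -[_ && _]/(uniq (u :: p)) Up.
Qed.

(** Connectedness matters here: without any path from [u] to [v] the minimum
    would be the default value [0]. *)
Lemma wdist_ge (R : realFieldType) (G : sgraph) (w : {set G} -> R)
    (u v : G) (c : R) : connected_graph G ->
  (forall p, path (@adj G) u p -> last u p = v -> uniq (u :: p) ->
     c <= path_weight w u p) ->
  c <= wdist w u v.
Proof.
move=> cG cP; have [q [qth lq Uq]] := simple_path u v cG.
have szq : (size q <= #|G|)%N.
  by apply/ltnW; rewrite (leq_trans _ (max_card (mem (u :: q)))) ?(card_uniqP Uq).
rewrite /wdist /=; set s := [seq _ | _ in _].
have sP x : x \in s -> c <= x.
  case/imageP=> p; rewrite inE => /and3P[pth /eqP lv Up] ->; exact: cP.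
have qs : path_weight w u q \in s.
  apply/imageP; exists (Bseq szq) => //.
  by rewrite inE /= qth lq eqxx -[_ && _]/(uniq (u :: q)) Uq.
rewrite big_seq; apply: le_bigmin => //; apply: sP.
by case: s qs => // x s _; rewrite inE eqxx.
Qed.

Lemma separated_wdist (R : realFieldType) (G : sgraph) (w : {set G} -> R)
    (e : {set G}) (u v : G) :
  connected_graph G -> weight_function w -> ~ connect (del e) u v ->
  w e <= wdist w u v.
Proof.
move=> cG w0 nuv; apply: wdist_ge => // p pth lv _.
apply: path_weight_ge_edge => //; apply/negPn/negP => ep.
exact: nuv (connect_del pth lv ep).
Qed.

Lemma wdist_le_wecc (R : realFieldType) (G : sgraph) (w : {set G} -> R)
    (u v : G) : wdist w u v <= wecc w v.
Proof.
by apply: (@le_bigmax_seq _ _ _ _ _ _ xpredT (wdist w ^~ v));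
  rewrite ?mem_index_enum.
Qed.

Lemma wecc_le (R : realFieldType) (G : sgraph) (w : {set G} -> R) (v : G) :
  connected_graph G -> weight_function w ->
  wecc w v <= \sum_(e in edges G) w e.
Proof.
move=> cG w0.
have wd u : wdist w u v <= \sum_(e in edges G) w e.
  have [p [pth lv Up]] := simple_path u v cG.
  exact: le_trans (wdist_le w pth lv Up) (path_weight_le w0 pth Up).
by apply: bigmax_le.
Qed.

Lemma wecc_ge (R : realFieldType) (G : sgraph) (w : {set G} -> R)
    (v : G) (c : R) :
  c <= wecc w v -> exists u, c <= wdist w u v.
Proof.
move=> cv; apply/existsP; apply: contraTT cv; rewrite negb_exists => /forallP cN.
by rewrite -ltNge; apply: bigmax_lt => [|u _]; rewrite ltNge.
Qed.

(** If the eccentricity of [a] is the total weight, then a simple path ending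
    at [a] contains every edge of positive weight.  If [{a, b}] is one of these
    edges, then all the others are on the side of [b]. *)
Lemma full_wecc_side (R : realFieldType) (G : sgraph) (w : {set G} -> R)
    (a b c d : G) :
  is_tree G -> weight_function w -> adj a b -> adj c d ->
  [set c; d] != [set a; b] -> 0 < w [set a; b] -> 0 < w [set c; d] ->
  \sum_(e in edges G) w e <= wecc w a ->
  ~ connect (del [set a; b]) c a.
Proof.
case=> cG acG w0 ab cd ne we wf /wecc_ge[u ecc_a] ca.
have [p [pth la Up]] := simple_path u a cG.
have full := le_trans ecc_a (wdist_le w pth la Up).
have abp : [set a; b] \in edge_seq u p.
  by apply: full_path_edge full _ we => //; apply/edgesP; exists a, b.
have cdp : [set c; d] \in edge_seq u p.
  by apply: full_path_edge full _ wf => //; apply/edgesP; exists c, d.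
have cp : c \in u :: p by apply: edge_seq_mem cdp _; rewrite !inE eqxx.
have dp : d \in u :: p by apply: edge_seq_mem cdp _; rewrite !inE eqxx orbT.
have toP := path_to_end pth la Up abp.
apply: (edge_is_bridge acG ab).
have ac : connect (del [set a; b]) a c by rewrite connect_del_sym.
have [cE|/(toP _ cp)] := eqVneq c a; last exact: connect_trans.
(* if [c = a], then [d] is the endpoint of the second edge other than [a] *)
have da : d != a by rewrite -cE eq_sym adj_neq.
apply: connect_trans (toP _ dp da).
by apply: connect1; rewrite /del /= -cE cd cE -{1}cE.
Qed.

Theorem theorem3p2 (R : realFieldType) (T : sgraph) (w : {set T} -> R)
    (n_ge2 : (2 <= #|T|)%N) (treeT : is_tree T)
    (w_ge0 : weight_function w) (w_norm : normalised w) :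
  avec w <= #|T|%:R - 1 /\
  (avec w = #|T|%:R - 1 <->
   exists2 e : {set T}, e \in edges T & w e = #|T|%:R - 1).
Proof.
have [cT acT] := treeT.
have n_gt0 : 0 < #|T|%:R :> R by rewrite ltr0n ltnW.
have [r _] : exists r : T, r \in T by apply/card_gt0P; rewrite ltnW.
have total : \sum_(e in edges T) w e = #|T|%:R - 1.
  by rewrite w_norm (card_edges_tree r treeT) -subn1 natrB // ltnW.
have ecc_le v : wecc w v <= #|T|%:R - 1 by rewrite -total wecc_le.
have sum_const : \sum_(v : T) (#|T|%:R - 1 : R) = (#|T|%:R - 1) * #|T|%:R.
  by rewrite sumr_const mulr_natr.
split; first by rewrite ler_pdivrMr // -sum_const ler_sum.
split=> [avE|[e eT we]]; last first.
  rewrite /avec; apply: (canLR (mulfK (lt0r_neq0 n_gt0))); rewrite -sum_const.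
  apply: eq_bigr => v _; apply/eqP; rewrite eq_le ecc_le /= -we.
  have /edgesP[x [y [xy eE]]] := eT.
  have [xv|/negP xv] := boolP (connect (del e) x v); last first.
    exact: le_trans (separated_wdist cT w_ge0 xv) (wdist_le_wecc w x v).
  have yv : ~ connect (del e) y v.
    move=> yv; apply: (edge_is_bridge acT xy); rewrite -eE.
    by apply: connect_trans xv _; rewrite connect_del_sym.
  exact: le_trans (separated_wdist cT w_ge0 yv) (wdist_le_wecc w y v).
have ecc_full v : \sum_(e in edges T) w e <= wecc w v.
  have ge0 u : true -> 0 <= #|T|%:R - 1 - wecc w u by rewrite subr_ge0.
  have sum0 : \sum_(u : T) (#|T|%:R - 1 - wecc w u) = 0.
    by rewrite sumrB sum_const -avE divfK ?subrr // lt0r_neq0.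
  by rewrite total -subr_le0 (psumr_eq0P ge0 sum0).
have total_gt0 : 0 < \sum_(e in edges T) w e.
  by rewrite total subr_gt0 ltr1n.
have [e /andP[eT we]] := psumr_neq0P w_ge0 (elimN eqP (lt0r_neq0 total_gt0)).
exists e => //; rewrite -total (bigD1 e) //=.
have [->|/eqP rest] := eqVneq (\sum_(f in edges T | f != e) w f) 0.
  by rewrite addr0.
have rest_ge0 f : (f \in edges T) && (f != e) -> 0 <= w f by case/andP=> /w_ge0.
have [f /andP[/andP[fT fe] wf]] := psumr_neq0P rest_ge0 rest.
have /edgesP[a [b [ab eE]]] := eT.
have /edgesP[c [d [cd fE]]] := fT.
rewrite {}eE {}fE in we wf fe.
have [ca|] := connect_end a b c cT.
  by case: (full_wecc_side treeT w_ge0 ab cd fe we wf (ecc_full a)).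
rewrite [[set a] :|: _]setUC in fe we *.
by case/(full_wecc_side treeT w_ge0 _ cd fe we wf (ecc_full b)); rewrite adj_sym.
Qed.
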